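(* For every integer $d\ge 1$, the following identities hold: (1) $P_d = \sum_{\delta \in \mathrm{PCom}_{\mathrm{sqf}}(d)} (-1)^{\ell(\delta)-1} L(\delta)\, H_\delta$; (2) $P_d = \sum_{\delta \in \mathrm{PCom}_{\mathrm{sqf}}(d)} (-1)^{\ell(\delta)} L(\delta)\, E_\delta$.
   Context: A composition of $n\ge 0$ is a finite tuple $\alpha=(\alpha_1,\dots,\alpha_k)$ of positive integers with sum $|\alpha|=n$; $\ell(\alpha)=k$; the empty composition is the only composition of $0$. A polycomposition of $n$ is a sequence $\delta=(\alpha^{(1)},\alpha^{(2)},\dots)$ of (possibly empty) compositions with $\sum_{i\ge1} i|\alpha^{(i)}|=n$; write $\delta|^i=\alpha^{(i)}$ and, formally (not exponentiation), $\delta=(\alpha^{(1)})^1(\alpha^{(2)})^2\cdots$, omitting empty compositions. Its length is $\ell(\delta)=\sum_i \ell(\delta|^i)$. Each part $d$ of $\delta|^r$ gives a block $d^r$ of $\delta$ (degree $d$, multiplicity $r$). For nonempty $\delta$ with largest multiplicity $r$ and $\alpha=\delta|^r$, set $L(\delta)=r\,\alpha_{\ell(\alpha)}$ (the size of the last block). $\mathrm{PCom}_{\mathrm{sqf}}(d)$ is the set of square-free polycompositions of $d$: those of the form $(\alpha)^1$ with $\alpha$ a composition of $d$. For such $\delta$, $L(\delta)$ is the last part of $\alpha$. Let $x_{i,j}$ ($i,j\ge 1$) be indeterminates with $\deg x_{i,j}=i$; all series have rational coefficients. A monomial is square-free if every exponent is at most $1$. $H_d$ is the sum of all monomials of degree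 $d$; $E_d$ is the sum over square-free monomials $f$ of degree $d$ of $(-1)^{m(f)}f$, where $m(f)$ is the number of indeterminates in $f$; for $d\ge1$, $P_d=\sum_{k\mid d}\sum_{j\ge1} k\,x_{k,j}^{d/k}$, with $k$ ranging over positive divisors of $d$. For $F\in\{H,E\}$ and a block $d^r$, $F_{d^r}$ is obtained from $F_d$ by replacing each $x_{i,j}$ by $x_{i,j}^r$, and for a polycomposition $\delta$, $F_\delta=\prod F_{d^r}$ over all blocks $d^r$ of $\delta$ (counted with repetition). *)

(* Defs.v *)
From HB Require Import structures.
From mathcomp Require Import all_boot all_order all_algebra.
From mathcomp Require Import finmap monalg.
From mathcomp Require Import boolp classical_sets functions cardinality fsbigop.

Set Implicit Arguments.
Unset Strict Implicit.
Unset Printing Implicit Defensive.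

Import GRing.Theory.

Local Open Scope classical_set_scope.
Local Open Scope ring_scope.

(* The pair (a, b) names the indeterminate x_{a+1,b+1}. *)
Definition indet : choiceType := (nat * nat)%type.

Definition monomial := {cmonom indet}.

(* A record rather than a bare function, so that [*] below is the Cauchy
   product and not the pointwise product of functions. *)
Record series := Series { coef : monomial -> rat }.

HB.instance Definition _ := [isNew for coef].
HB.instance Definition _ := [Choice of series by <:].

Lemma seriesP (f g : series) : coef f =1 coef g -> f = g.
Proof. by move=> /funext; exact: val_inj. Qed.

Section SeriesZmod.
Implicit Types f g h : series.

Definition series0 := Series (fun=> 0).
Definition series_opp f := Series (fun m => - coef f m).
Definition series_add f g := Series (fun m => coef f m + coef g m).

Lemma series_addA : associative series_add.
Proof. by move=> f g h; apply: seriesP => m /=; rewrite addrA. Qed.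
Lemma series_addC : commutative series_add.
Proof. by move=> f g; apply: seriesP => m /=; rewrite addrC. Qed.
Lemma series_add0 : left_id series0 series_add.
Proof. by move=> f; apply: seriesP => m /=; rewrite add0r. Qed.
Lemma series_addN : left_inverse series0 series_opp series_add.
Proof. by move=> f; apply: seriesP => m /=; rewrite addNr. Qed.

HB.instance Definition _ := GRing.isZmodule.Build series
  series_addA series_addC series_add0 series_addN.
End SeriesZmod.

Definition factorizations (m : monomial) : set (monomial * monomial) :=
  [set p | mmul p.1 p.2 = m].

Lemma finite_divisors (m : monomial) :
  finite_set [set u : monomial | forall v, (u v <= m v)%N].
Proof.
pose D := finsupp m.
pose g (phi : {ffun D -> 'I_(mdeg m).+1}) : monomial :=
  [cmonom (phi i : nat) | i : D]%M.
apply: (@sub_finite_set _ _ (g @` setT)); last exact/finite_image/finite_finset.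
move=> u /= le_um.
exists [ffun v : D => inord (u (val v))] => //.
apply/eqP/cmP => v; rewrite /g cmE.
have [vD|vD] := boolP (v \in D); last first.
  rewrite fsfun_ffun insubF; last exact/negbTE.
  by have := le_um v; rewrite (fsfun_dflt vD) leqn0 => /eqP ->.
rewrite fsfun_ffun insubT /= ffunE inordK // ltnS.
apply: leq_trans (le_um v) _.
by rewrite mdegE (big_fsetD1 v vD) /= leq_addr.
Qed.

Lemma finite_factorizations (m : monomial) : finite_set (factorizations m).
Proof.
have finD := finite_divisors m.
apply: sub_finite_set (finite_setX finD finD) => -[u w] /= <-.
by split=> v /=; rewrite cmM (leq_addr, leq_addl).
Qed.

Definition series_mul (f g : series) :=
  Series (fun m => \sum_(p \in factorizations m) coef f p.1 * coef g p.2).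

Definition series1 := Series (fun m => (m == mone)%:R).

Section SeriesRing.
Implicit Types f g h : series.

Let D (m : monomial) : seq (monomial * monomial) := fset_set (factorizations m).

Let inD m p : (p \in D m) = (mmul p.1 p.2 == m).
Proof.
rewrite [LHS](in_fset_set (finite_factorizations m)).
by apply/idP/eqP; rewrite inE.
Qed.

Lemma coefM f g m :
  coef (series_mul f g) m =
  \sum_(p <- fset_set (factorizations m)) coef f p.1 * coef g p.2.
Proof. by rewrite /= fsbig_finite //; exact: finite_factorizations. Qed.

Let uniq_triples (T : eqType) (f : monomial * monomial -> monomial * monomial -> T)
    (k : monomial * monomial -> monomial) (m : monomial) :
    (forall p q p' q', mmul q.1 q.2 = k p -> mmul q'.1 q'.2 = k p' ->
      f p q = f p' q' -> p = p' /\ q = q') ->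
  uniq [seq f p q | p <- D m, q <- D (k p)].
Proof.
move=> f_inj; apply: allpairs_uniq_dep => [|p _|]; rewrite ?fset_uniq//.
move=> _ _ /allpairsPdep[p [q [_ qD ->]]] /allpairsPdep[p' [q' [_ qD' ->]]] /=.
move: qD qD'; rewrite !inD => /eqP qp /eqP qp' eq_f.
by have [-> ->] := f_inj _ _ _ _ qp qp' eq_f.
Qed.

Lemma series_mulA : associative series_mul.
Proof.
move=> f g h; apply: seriesP => m; rewrite !coefM.
pose F (t : monomial * monomial * monomial) :=
  coef f t.1.1 * coef g t.1.2 * coef h t.2.
transitivity (\sum_(t <- [seq (p.1, q.1, q.2) | p <- D m, q <- D p.2]) F t).
  rewrite big_allpairs_dep; apply: eq_bigr => p _.
  by rewrite coefM mulr_sumr; apply: eq_bigr => q _; rewrite mulrA.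
transitivity (\sum_(t <- [seq (q.1, q.2, p.2) | p <- D m, q <- D p.1]) F t).
  apply: perm_big; apply: uniq_perm.
  - apply: (uniq_triples (k := snd)).
    by move=> [a b] [c d] [a' b'] [c' d'] /= <- <- [-> -> ->].
  - apply: (uniq_triples (k := fst)).
    by move=> [a b] [c d] [a' b'] [c' d'] /= <- <- [-> -> ->].
  - move=> [[a b] c]; apply/allpairsPdep/allpairsPdep => -[p [q]].
      rewrite !inD => -[/eqP em /eqP ep [-> -> ->]].
      exists (mmul p.1 q.1, q.2), (p.1, q.1).
      by rewrite !inD /= eqxx -mulmA ep em eqxx.
    rewrite !inD => -[/eqP em /eqP ep [-> -> ->]].
    exists (q.1, mmul q.2 p.2), (q.2, p.2).
    by rewrite !inD /= eqxx mulmA ep em eqxx.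
rewrite big_allpairs_dep; apply: eq_bigr => p _.
by rewrite coefM mulr_suml.
Qed.

Lemma series_mulC : commutative series_mul.
Proof.
move=> f g; apply: seriesP => m; rewrite !coefM.
pose sw (p : monomial * monomial) := (p.2, p.1).
have swK : involutive sw by case.
rewrite [RHS](perm_big [seq sw p | p <- D m]).
  by rewrite big_map; apply: eq_bigr => p _; rewrite mulrC.
apply: uniq_perm; rewrite ?(map_inj_uniq (inv_inj swK)) ?fset_uniq// => p.
by rewrite -[p]swK (mem_map (inv_inj swK)) !inD /= mulmC.
Qed.

Lemma series_mul1 : left_id series1 series_mul.
Proof.
move=> f; apply: seriesP => m; rewrite coefM.
rewrite (bigD1_seq (mone, m)) ?fset_uniq ?inD ?mul1m//=.
rewrite eqxx mul1r big_seq_cond big1 ?addr0// => -[a b] /andP[].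
rewrite inD /= => /eqP <-; have [->|_ _] := eqVneq a mone.
  by rewrite mul1m eqxx.
by rewrite mul0r.
Qed.

Lemma series_mulDl : left_distributive series_mul +%R.
Proof.
move=> f g h; apply: seriesP => m.
transitivity (coef (series_mul f h) m + coef (series_mul g h) m); last by [].
rewrite !coefM -big_split; apply: eq_bigr => p _.
by rewrite mulrDl.
Qed.

Lemma series1_neq0 : series1 != 0.
Proof.
apply/eqP => /(congr1 (fun f => coef f mone)) /= /eqP.
by rewrite eqxx oner_eq0.
Qed.

HB.instance Definition _ := GRing.Zmodule_isComNzRing.Build series
  series_mulA series_mulC series_mul1 series_mulDl series1_neq0.
End SeriesRing.

Definition monomial_series (u : monomial) : series :=
  Series (fun m => (m == u)%:R).

(* x_{i,j}, for i, j >= 1 *)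
Definition xvar (i j : nat) : series := monomial_series (ucm (i.-1, j.-1)).

(* Coefficientwise sum; meaningful when each monomial has a nonzero coefficient
   in only finitely many [F j]. *)
Definition series_sum (F : nat -> series) : series :=
  Series (fun m => \sum_(j \in [set: nat]) coef (F j) m).

(* Substitution of x_{i,j}^r for every x_{i,j}. For r >= 1 the sum has at most
   one term, the monomial u with u^r = m. *)
Definition subst_pow (r : nat) (F : series) : series :=
  Series (fun m =>
    \sum_(u \in [set u : monomial | forall v, m v = (r * u v)%N]) coef F u).

(* deg x_{i,j} = i, hence the successor. *)
Definition degree (m : monomial) : nat :=
  (\sum_(v <- finsupp m) m v * v.1.+1)%N.

Definition squarefree (m : monomial) : bool :=
  all (fun v => m v <= 1)%N (finsupp m).

Definition H_ (d : nat) : series := Series (fun m => (degree m == d)%:R).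

Definition E_ (d : nat) : series :=
  Series (fun m => if squarefree m && (degree m == d)
                   then (-1) ^+ #|` finsupp m| else 0).

Definition P_ (d : nat) : series :=
  \sum_(k <- divisors d) series_sum (fun j => k%:R * xvar k j.+1 ^+ (d %/ k)).

Definition composition (a : seq nat) : bool := all (leq 1) a.

(* [delta r] is the composition delta|^r. Multiplicities start at 1, so
   [delta 0] is a dummy component, required below to be empty. *)
Definition indexed_comp := {fsfun nat -> seq nat with [::]}.

Definition PCom (n : nat) : set indexed_comp :=
  [set delta : indexed_comp |
    [/\ delta 0%N = [::], (forall r, composition (delta r))
      & (\sum_(r <- finsupp delta) r * sumn (delta r))%N = n]].

(* The polycomposition written (a)^1. *)
Definition mult_one (a : seq nat) : indexed_comp := [fsfun [fsfun] with 1%N |-> a].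

Definition PCom_sqf (d : nat) : set indexed_comp :=
  [set delta | PCom d delta /\
    exists a, [/\ composition a, sumn a = d & delta = mult_one a]].

Definition plength (delta : indexed_comp) : nat :=
  (\sum_(r <- finsupp delta) size (delta r))%N.

Definition max_mult (delta : indexed_comp) : nat := (\max_(r <- finsupp delta) r)%N.

Definition L (delta : indexed_comp) : nat :=
  (max_mult delta * last 0 (delta (max_mult delta)))%N.

(* The pair (d, r) stands for the block d^r. *)
Definition blocks (delta : indexed_comp) : seq (nat * nat) :=
  [seq (d, r) | r <- finsupp delta, d <- delta r].

Definition block_prod (F : nat -> series) (delta : indexed_comp) : series :=
  \prod_(b <- blocks delta) subst_pow b.2 (F b.1).

(* Main.v *)
(* With H(t) = prod 1/(1 - x_{i,j} t^i) and E(t) = 1/H(t), the logarithmic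
   derivative t H'/H = - t E'/E equals sum_d P_d t^d.  This gives the Newton
   identities
     sum_{1 <= a <= d} P_a H_{d-a} = d H_d,
     sum_{1 <= a <= d} P_a E_{d-a} = - d E_d,
   which are checked here on coefficients.  Each of them determines the P_a
   recursively, and the sums over compositions satisfy the same recursion:
   split off the first part. *)
Require Import Defs.
From mathcomp Require Import all_boot all_order all_algebra.
From mathcomp Require Import finmap monalg.
From mathcomp Require Import zify ring.
From mathcomp Require Import boolp classical_sets cardinality fsbigop.

Set Implicit Arguments.
Unset Strict Implicit.
Unset Printing Implicit Defensive.

Import GRing.Theory.
Local Open Scope ring_scope.

Implicit Types (m u w : monomial) (f : series) (v : indet).

(** * Coefficients of products, and powers of one indeterminate *)

Lemma coef_sum (I : Type) (r : seq I) (Q : pred I) (F : I -> series) m :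
  coef (\sum_(i <- r | Q i) F i) m = \sum_(i <- r | Q i) coef (F i) m.
Proof. exact: (big_morph (fun f => coef f m)). Qed.

Lemma coef_natl n f m : coef (n%:R * f) m = n%:R * coef f m.
Proof.
rewrite !mulr_natl; elim: n => // n IHn.
by rewrite !mulrS -IHn.
Qed.

Lemma coef_mul f g m : coef (f * g) m =
  \sum_(p <- fset_set (factorizations m)) coef f p.1 * coef g p.2.
Proof. exact: Defs.coefM. Qed.

Definition vpow (v : indet) (e : nat) : monomial :=
  [cmonom e | _ in [fset v]%fset]%M.

Lemma vpowE v e i : vpow v e i = if i == v then e else 0%N.
Proof. by rewrite /vpow cmE fsfun_fun in_fset1. Qed.

(** Evaluating both sides at [v] suffices; positivity is essential, as [vpow v 0] is [mone] for
    every [v]. *)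
Lemma vpow_inj v e i k : (0 < e)%N -> vpow v e = vpow i k -> v = i /\ e = k.
Proof.
move=> e_gt0 /(congr1 (fun m : monomial => m v)).
by rewrite !vpowE eqxx; case: eqP => [->|_ e0]; [|rewrite e0 in e_gt0].
Qed.

Lemma vpow0 v : vpow v 0 = mone.
Proof. by apply/eqP/cmP => w; rewrite vpowE cm1 if_same. Qed.

Lemma vpow_mul v e k : mmul (vpow v e) (vpow v k) = vpow v (e + k).
Proof. by apply/eqP/cmP => w; rewrite cmM !vpowE; case: eqP. Qed.

Lemma mulK_divcm u w : divcm (mmul u w) u = w.
Proof. by apply/eqP/cmP => v; rewrite divcmE cmM addKn. Qed.

Lemma divcmK m u : (forall v, (u v <= m v)%N) -> mmul u (divcm m u) = m.
Proof. by move=> le_um; apply/eqP/cmP => v; rewrite cmM divcmE subnKC. Qed.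

Lemma mem_factorizations m p :
  (p \in fset_set (factorizations m)) = (mmul p.1 p.2 == m).
Proof.
rewrite (in_fset_set (finite_factorizations m)).
by apply/idP/eqP; rewrite inE.
Qed.

Lemma coef_monomialM u f m : (forall v, (u v <= m v)%N) ->
  coef (monomial_series u * f) m = coef f (divcm m u).
Proof.
move=> le_um; rewrite coef_mul.
rewrite (bigD1_seq (u, divcm m u)) ?fset_uniq ?mem_factorizations ?divcmK//=.
rewrite eqxx mul1r big_seq_cond big1 ?addr0// => -[a b] /andP[].
rewrite mem_factorizations /= => /eqP <-; have [->|_ _] := eqVneq a u.
  by rewrite mulK_divcm eqxx.
by rewrite mul0r.
Qed.

Lemma monomial_seriesM u w :
  monomial_series u * monomial_series w = monomial_series (mmul u w).
Proof.
apply: seriesP => m; rewrite [RHS]/=.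
have [le_um|nle_um] := pselect (forall v, (u v <= m v)%N).
  rewrite coef_monomialM //=; congr (nat_of_bool _)%:R.
  by apply/eqP/eqP => [<-|->]; rewrite ?divcmK ?mulK_divcm.
rewrite coef_mul big_seq big1 => [|[a b]].
  by case: eqP => // em; case: nle_um => v; rewrite em cmM leq_addr.
rewrite mem_factorizations /= => /eqP em.
case: eqP => [ea|]; last by rewrite mul0r.
by case: nle_um => v; rewrite -em ea cmM leq_addr.
Qed.

Lemma xvarX k j e : xvar k j ^+ e = monomial_series (vpow (k.-1, j.-1) e).
Proof.
elim: e => [|e IHe]; first by rewrite vpow0.
rewrite exprS IHe monomial_seriesM.
congr monomial_series.
exact: (vpow_mul _ 1 e).
Qed.

(** * Coefficients of [P_ a] and of its multiples *)

Lemma coef_P a u : coef (P_ a) u =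
  \sum_(k <- divisors a) \sum_(j \in [set: nat])
    (k%:R * (u == vpow (k.-1, j) (a %/ k))%:R : rat).
Proof.
rewrite coef_sum; apply: eq_bigr => k _; apply: eq_fsbigr => j _.
by rewrite coef_natl xvarX.
Qed.

(** A positive power determines its indeterminate and its exponent, so only [k = v.1.+1] and
    [j = v.2] can contribute, and then only if [a %/ k = e]. *)
Lemma coef_P_vpow a v e : (0 < a)%N -> (0 < e)%N ->
  coef (P_ a) (vpow v e) = if (e * v.1.+1 == a)%N then v.1.+1%:R else 0.
Proof.
move=> a_gt0 e_gt0; rewrite coef_P.
have off k j : (0 < k)%N -> (k, j, (a %/ k)%N) != (v.1.+1, v.2, e) ->
  k%:R * (vpow v e == vpow (k.-1, j) (a %/ k))%:R = 0 :> rat.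
  move=> k_gt0 ne.
  case: eqP => [/(vpow_inj e_gt0)[ev ek]|]; last by rewrite mulr0.
  by case/eqP: ne; rewrite -ek ev /= prednK.
have div_gt0 k : k \in divisors a -> (0 < k)%N.
  by rewrite -dvdn_divisors // => /dvdn_gt0; apply.
have [ea|ne] := eqVneq.
  rewrite (bigD1_seq v.1.+1) ?divisors_uniq -?dvdn_divisors -?ea ?dvdn_mull
    ?muln_gt0 ?e_gt0//=.
  rewrite [X in _ + X]big_seq_cond [X in _ + X]big1 ?addr0; last first.
    move=> k /andP[kd nek]; apply: fsbig1 => j _; rewrite ea; apply: off.
      by apply: div_gt0; rewrite -ea.
    by apply: contraNneq nek => -[->].
  rewrite (@fsbigTE _ _ _ _ [fset v.2]%fset) => [|j].
    by rewrite big_seq_fset1 mulnK // -surjective_pairing eqxx mulr1.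
  rewrite in_fset1 => nej; rewrite ea; apply: off => //.
  by apply: contraNneq nej => -[->].
rewrite big_seq big1 // => k kd; apply: fsbig1 => j _.
apply: off; rewrite ?div_gt0//.
apply: contraNneq ne => -[<- _ <-].
by rewrite divnK // dvdn_divisors.
Qed.

Lemma coef_P0 a u : (0 < a)%N -> (forall v e, (0 < e)%N -> u <> vpow v e) ->
  coef (P_ a) u = 0.
Proof.
move=> a_gt0 neu; rewrite coef_P big_seq big1 // => k.
rewrite -dvdn_divisors // => kda; apply: fsbig1 => j _.
case: eqP; rewrite ?mulr0 // => /neu [].
rewrite divn_gt0; first exact: dvdn_leq.
exact: dvdn_gt0 kda.
Qed.

(** On the divisors of a fixed [m], the infinite sum [P_ a] agrees with a finite one, over the
    powers of indeterminates that divide [m]. *)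
Lemma coef_P_dvd a m u : (0 < a)%N -> (forall v, (u v <= m v)%N) ->
  coef (P_ a) u =
  \sum_(v <- finsupp m) \sum_(1 <= e < (m v).+1 | (e * v.1.+1 == a)%N)
    v.1.+1%:R * (u == vpow v e)%:R.
Proof.
move=> a_gt0 le_um.
have [[v [e [e_gt0 eu]]]|nu] := pselect (exists v e, (0 < e)%N /\ u = vpow v e);
    last first.
  rewrite coef_P0 // => [|v e e_gt0 eu]; last by apply: nu; exists v, e.
  rewrite big1 // => v _.
  rewrite big_nat_cond big1 // => e /andP[/andP[e_gt0 _] _].
  by case: eqP => [eu|]; [case: nu; exists v, e | rewrite mulr0].
have le_e : (e <= m v)%N by have := le_um v; rewrite eu vpowE eqxx.
have vm : v \in finsupp m by rewrite -cmE_neq0 -lt0n (leq_trans e_gt0).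
have off i k : (i, k) != (v, e) -> (vpow v e == vpow i k)%:R = 0 :> rat.
  move=> ne; case: eqP => // /(vpow_inj e_gt0)[ev ek].
  by rewrite ev ek eqxx in ne.
rewrite {}eu coef_P_vpow // (big_fsetD1 v) //=.
rewrite [X in _ + X]big_seq [X in _ + X]big1 ?addr0 => [|i]; last first.
  rewrite in_fsetD1 => /andP[new _]; apply: big1 => k _.
  by rewrite off ?mulr0 //; apply: contraNneq new => -[->].
rewrite big_mkcond (bigD1_seq e) ?iota_uniq ?mem_index_iota ?ltnS ?e_gt0 //=.
rewrite eqxx mulr1 big1 ?addr0 // => k nek; case: ifP => // _.
by rewrite off ?mulr0 //; apply: contraNneq nek => -[->].
Qed.

Lemma coef_PM a f m : (0 < a)%N ->
  coef (P_ a * f) m =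
  \sum_(v <- finsupp m) \sum_(1 <= e < (m v).+1 | (e * v.1.+1 == a)%N)
    v.1.+1%:R * coef f (divcm m (vpow v e)).
Proof.
move=> a_gt0.
(* The truncation of [P_ a] to divisors of [m]. Every first factor in a factorization of [m] divides
   [m], so [Q] may replace [P_ a]. *)
pose Q := \sum_(v <- finsupp m) \sum_(1 <= e < (m v).+1 | (e * v.1.+1 == a)%N)
  v.1.+1%:R * monomial_series (vpow v e).
transitivity (coef (Q * f) m).
  rewrite !coef_mul; apply: eq_big_seq => p.
  rewrite mem_factorizations => /eqP em.
  congr (_ * _); rewrite (coef_P_dvd (m := m)) // => [|v]; last first.
    by rewrite -em cmM leq_addr.
  rewrite coef_sum; apply: eq_bigr => v _.
  rewrite coef_sum; apply: eq_bigr => e _.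
  by rewrite coef_natl.
rewrite mulr_suml coef_sum; apply: eq_bigr => v _.
rewrite mulr_suml coef_sum big_nat_cond [RHS]big_nat_cond.
apply: eq_bigr => e /andP[/andP[_ le_e] _].
rewrite -mulrA coef_natl coef_monomialM // => w.
by rewrite vpowE; case: eqP => [->|].
Qed.

(** * Degrees and the Newton identities *)

Lemma degreeE (S : {fset indet}) m : (finsupp m `<=` S)%fset ->
  degree m = (\sum_(v <- S) m v * v.1.+1)%N.
Proof.
move=> leS; apply: big_fset_incl => // v _ vm.
by rewrite fsfun_dflt.
Qed.

Lemma degreeM u w : degree (mmul u w) = (degree u + degree w)%N.
Proof.
rewrite (degreeE (S := finsupp u `|` finsupp w)%fset) ?mdomD //.
rewrite (degreeE (m := u) (fsubsetUl _ (finsupp w))).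
rewrite (degreeE (m := w) (fsubsetUr (finsupp u) _)) -big_split /=.
by apply: eq_bigr => v _; rewrite cmM mulnDl.
Qed.

Lemma degree_vpow v e : degree (vpow v e) = (e * v.1.+1)%N.
Proof.
rewrite (degreeE (S := [fset v]%fset)) ?big_seq_fset1 ?vpowE ?eqxx //.
apply/fsubsetP => i; rewrite -cmE_neq0 vpowE in_fset1.
by case: ifP.
Qed.

Lemma degree_divcm m v e : (e <= m v)%N ->
  degree m = (e * v.1.+1 + degree (divcm m (vpow v e)))%N.
Proof.
move=> le_e; rewrite -degree_vpow -degreeM divcmK // => w.
by rewrite vpowE; case: eqP => [->|].
Qed.

(** [H_ n] and [E_ n] both have this form with [g] independent of [n], so one computation serves
    both Newton identities. *)
Definition homogeneous_part (g : monomial -> rat) (n : nat) : series :=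
  Series (fun m => if degree m == n then g m else 0).

(** A power [vpow v e] dividing [m] occurs only in the [P_ a] with [a = e * v.1.+1], and the
    quotient has degree [d - a] exactly when [m] has degree [d]. So the sum over [a] collapses. *)
Lemma coef_sum_P_homogeneous g d m :
  coef (\sum_(1 <= a < d.+1) P_ a * homogeneous_part g (d - a)) m =
  if degree m == d then
    \sum_(v <- finsupp m) v.1.+1%:R *
      \sum_(1 <= e < (m v).+1) g (divcm m (vpow v e))
  else 0.
Proof.
have le_deg v e : (e <= m v)%N -> (e * v.1.+1 <= degree m)%N.
  by move=> /degree_divcm ->; rewrite leq_addr.
rewrite coef_sum big_nat_cond.
under eq_bigr => a /andP[/andP[a_gt0 _] _] do rewrite coef_PM //.
rewrite -big_nat_cond exchange_big /=.
transitivity (\sum_(v <- finsupp m) if degree m == d then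
    v.1.+1%:R *
      \sum_(1 <= e < (m v).+1) g (divcm m (vpow v e)) else 0); last first.
  by case: eqP => // _; rewrite big1.
apply: eq_bigr => v _.
rewrite (exchange_big_dep predT) //=.
rewrite (eq_big_nat _ _ (F2 := fun e =>
    if degree m == d then v.1.+1%:R * g (divcm m (vpow v e)) else 0)).
  by case: eqP => _; [rewrite mulr_sumr | rewrite big1].
move=> e /andP[e_gt0 le_e].
transitivity (\sum_(1 <= a < d.+1 | a == (e * v.1.+1)%N)
    if degree m == d then v.1.+1%:R * g (divcm m (vpow v e)) else 0).
  rewrite big_nat_cond [RHS]big_nat_cond.
  apply: eq_big => [a|a /andP[/andP[_ le_ad] /eqP ea]]; first by rewrite eq_sym.
  rewrite (degree_divcm le_e) -[d in RHS](subnKC (m := a)) // -ea eqn_add2l /=.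
  by case: ifP; rewrite ?mulr0.
(* The single index [e * v.1.+1] is in range when [degree m = d], by [le_deg]; otherwise both sides
   are 0. *)
rewrite big_nat1_eq muln_gt0 e_gt0 /= ltnS.
by case: (eqVneq (degree m)) => [<-|_]; rewrite ?le_deg ?if_same.
Qed.

(** With [g = 1] the inner sum counts [m v] exponents, and the total is [degree m]. *)
Lemma newton_H d :
  \sum_(1 <= a < d.+1) P_ a * H_ (d - a) = d%:R * H_ d.
Proof.
have HE n : H_ n = homogeneous_part (fun=> 1) n.
  by apply: seriesP => m /=; case: eqP.
under eq_bigr do rewrite HE.
apply: seriesP => m; rewrite coef_sum_P_homogeneous coef_natl /=.
case: eqP => [<-|]; last by rewrite mulr0.
rewrite mulr1 (degreeE (fsubset_refl _)) natr_sum; apply: eq_bigr => v _.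
by rewrite sumr_const_nat subSS subn0 natrM mulrC.
Qed.

(* The coefficient of x^n in 1 - x. *)
Definition E_weight (n : nat) : rat := if n is n'.+1 then - (n' == 0)%:R else 1.

(** Both sides are the coefficient of x^n in x: the left from x (1 - x) / (1 - x), the right from -x
    times the derivative of 1 - x. This is the Newton identity for one indeterminate. *)
Lemma sum_E_weight n : \sum_(0 <= i < n) E_weight i = - (n%:R * E_weight n).
Proof.
elim: n => [|[|n] IHn]; first by rewrite big_geq // mul0r oppr0.
  by rewrite big_nat1 mulrN mulr1 opprK.
rewrite big_nat_recr //= IHn; case: n {IHn} => [|n] /=.
  by ring.
by ring.
Qed.

(** The [E_ n] add up to the product of all 1 - x_v, whose coefficients factor over the
    indeterminates; an exponent above 1 gives a zero factor. *)
Lemma E_homogeneous n :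
  E_ n = homogeneous_part (fun m => \prod_(v <- finsupp m) E_weight (m v)) n.
Proof.
apply: seriesP => m /=; rewrite andbC; case: eqP => //= _.
case: ifPn => [/allP sqf|/allPn[v vm]].
  transitivity (\prod_(v <- finsupp m) (-1 : rat)).
    by rewrite big_const_seq count_predT iter_mulr_1.
  apply: eq_big_seq => v vm; have := sqf _ vm; rewrite -cmE_neq0 in vm.
  by case: (m v) vm => [|[|]].
rewrite -ltnNge => mv_gt1; rewrite (big_fsetD1 v) //=.
by case: (m v) mv_gt1 => [|[|k]] // _; rewrite /= oppr0 mul0r.
Qed.

Lemma coef_opp f m : coef (- f) m = - coef f m.
Proof. by []. Qed.

Lemma newton_E d :
  \sum_(1 <= a < d.+1) P_ a * E_ (d - a) = - (d%:R * E_ d).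
Proof.
under eq_bigr do rewrite E_homogeneous.
apply: seriesP => m; rewrite coef_sum_P_homogeneous.
rewrite coef_opp coef_natl E_homogeneous /=.
case: eqP => [<-|]; last by rewrite mulr0 oppr0.
rewrite (degreeE (fsubset_refl _)) natr_sum mulr_suml -sumrN.
apply: eq_big_seq => v vm.
(* Dividing by a power of [v] changes only the factor at [v], so [C] comes out and one indeterminate
   remains. *)
pose C := \prod_(i <- (finsupp m `\ v)%fset) E_weight (m i).
have prodE e : \prod_(i <- finsupp (divcm m (vpow v e)))
    E_weight (divcm m (vpow v e) i) = E_weight (m v - e) * C.
  (* The quotient may lose [v] from its support; [E_weight 0 = 1] allows the larger index set. *)
  rewrite (@big_fset_incl _ _ _ _ _ (finsupp m)).
  - rewrite (big_fsetD1 v) //= divcmE vpowE eqxx; congr (_ * _).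
    apply: eq_big_seq => i; rewrite in_fsetD1 divcmE vpowE => /andP[/negPf-> _].
    by rewrite subn0.
  - apply/fsubsetP => i; rewrite -!cmE_neq0 divcmE.
    by apply: contraNneq => ->.
  - by move=> i _ /fsfun_dflt ->.
under eq_bigr do rewrite prodE.
rewrite -mulr_suml (big_fsetD1 v) //= -/C.
(* Reversal turns [m v - e], for [e] from 1 to [m v], into an index running from 0 to [m v - 1]. *)
rewrite big_add1 /= big_nat_rev /= add0n.
rewrite (eq_big_nat _ _ (F2 := E_weight)) => [|i /andP[_ lt_i]]; last first.
  by congr E_weight; lia.
rewrite sum_E_weight natrM; ring.
Qed.

(** * Initial values and the recursion over compositions *)

Lemma degree_eq0 m : (degree m == 0%N) = (m == mone).
Proof.
apply/idP/eqP => [|->]; last by rewrite /degree mdom1 big_seq_fset0.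
rewrite sum_nat_seq_eq0 => /allP m0; apply/eqP/cmP => v; rewrite cm1.
apply/eqP; rewrite cmE_eq0; apply/negP => vm.
by have := m0 v vm; rewrite muln_eq0 orbF cmE_eq0 vm.
Qed.

Lemma H_0 : H_ 0 = 1.
Proof. by apply: seriesP => m /=; rewrite degree_eq0. Qed.

Lemma E_0 : E_ 0 = 1.
Proof.
apply: seriesP => m /=; rewrite degree_eq0 andbC.
by case: eqP => //= ->; rewrite /squarefree mdom1.
Qed.

(* The compositions of [d]; [n >= d] is fuel for the recursion. *)
Fixpoint compositions (n d : nat) : seq (seq nat) :=
  if d is 0 then [:: [::]] else
  if n is n'.+1 then [seq b :: a | b <- iota 1 d, a <- compositions n' (d - b)]
  else [::].

Lemma compositions0 n : compositions n 0 = [:: [::]].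
Proof. by case: n. Qed.

Lemma compositionsS n d : compositions n.+1 d.+1 =
  [seq b :: a | b <- iota 1 d.+1, a <- compositions n (d.+1 - b)].
Proof. by []. Qed.

Lemma mem_compositions n d a : (d <= n)%N ->
  (a \in compositions n d) = composition a && (sumn a == d).
Proof.
elim: n d a => [|n IHn] [|d] a //; rewrite ?mem_seq1 => le_dn.
- by case: a => [|[|b] a] //=; rewrite addSn andbF.
- by case: a => [|[|b] a] //=; rewrite addSn andbF.
rewrite compositionsS; apply/allpairsPdep/andP => [[b [c []]]|[]].
  rewrite mem_iota => /andP[b_gt0 le_b]; rewrite IHn; last by lia.
  by move=> /andP[comp_c /eqP sum_c] -> /=; split; [apply/andP|apply/eqP; lia].
case: a => // b c /andP[b_gt0 comp_c] /eqP sum_bc.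
have {}sum_bc : (b + sumn c = d.+1)%N := sum_bc.
exists b, c; rewrite mem_iota IHn; last by lia.
split=> //; first by lia.
by apply/andP; split => //; apply/eqP; lia.
Qed.

Lemma uniq_compositions n d : uniq (compositions n d).
Proof.
elim: n d => [|n IHn] [|d] //; rewrite compositionsS.
apply: allpairs_uniq_dep; rewrite ?iota_uniq //.
by move=> [b a] [c e] _ _ /= [-> ->].
Qed.

(** Prepending a part [b] to a nonempty composition flips the sign and keeps the last part, so these
    terms sum to [- F b * p (d - b)]. With [d * F d] from the one-part composition, [newton] leaves
    [p d]. *)
Lemma sum_compositions_newton (F p : nat -> series) : F 0 = 1 ->
  (forall d, \sum_(1 <= a < d.+1) p a * F (d - a)%N = d%:R * F d) ->
  forall n d, (0 < d <= n)%N ->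
  \sum_(a <- compositions n d)
    (-1) ^+ (size a - 1) * (last 0%N a)%:R * \prod_(b <- a) F b = p d.
Proof.
move=> F0 newton; elim=> [|n IHn] [|d] // le_dn.
rewrite compositionsS big_allpairs_dep -[iota 1 d.+1]/(index_iota 1 d.+2).
(* The first part exhausts the total: this term becomes the right side of [newton]. *)
rewrite big_nat_recr //= subnn compositions0 !big_seq1 /= subnn expr0 mul1r.
rewrite -newton [X in _ + X]big_nat_recr //= subnn F0 mulr1 addrA.
rewrite [X in X + _](_ : _ = 0) ?add0r //.
(* After reversal, first part [b] faces [p (d.+1 - b) * F b], and the terms cancel in pairs. *)
rewrite [X in _ + X]big_nat_rev /= -big_split big_nat.
rewrite big1 //= => b /andP[b_gt0 b_le].
have -> : (1 + d.+1 - b.+1 = d.+1 - b)%N by lia.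
have -> : (d.+1 - (d.+1 - b) = b)%N by lia.
have <- := IHn (d.+1 - b)%N; last by lia.
rewrite mulr_suml -big_split big_seq big1 //= => a.
rewrite mem_compositions; last by lia.
(* The rest has positive sum, so it is nonempty and its last part is that of the whole. *)
case: a => [|c a] /=; first by case: eqP => //; lia.
by rewrite !subn1 /= big_cons => _; rewrite exprS; ring.
Qed.

(** * Square-free polycompositions as compositions *)

Lemma mult_oneE a r : mult_one a r = if r == 1%N then a else [::].
Proof. by rewrite fsfun_withE; case: ifP; rewrite ?fsfun0E. Qed.

(** For [a = [::]], the default value, the support would be empty; compositions of a positive [d]
    avoid this. *)
Lemma finsupp_mult_one a : a != [::] -> finsupp (mult_one a) = [fset 1%N]%fset.
Proof.
move=> a_neq0; apply/fsetP => r; rewrite mem_finsupp mult_oneE in_fset1.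
by case: (r == 1%N); rewrite ?eqxx.
Qed.

Lemma plength_mult_one a : a != [::] -> plength (mult_one a) = size a.
Proof.
by move=> a_neq0; rewrite /plength finsupp_mult_one // big_seq_fset1 mult_oneE.
Qed.

Lemma L_mult_one a : a != [::] -> L (mult_one a) = last 0%N a.
Proof.
move=> a_neq0; rewrite /L /max_mult finsupp_mult_one // big_seq_fset1.
by rewrite mult_oneE mul1n.
Qed.

Lemma subst_pow1 f : subst_pow 1 f = f.
Proof.
apply: seriesP => m /=.
rewrite (_ : [set u | _]%classic = [set m]%classic) ?fsbig_set1 //.
apply/seteqP; split => u /=; last by move=> -> v; rewrite mul1n.
by move=> eu; apply/esym/eqP/cmP => v; rewrite eu mul1n.
Qed.

Lemma block_prod_mult_one F a : a != [::] ->
  block_prod F (mult_one a) = \prod_(b <- a) F b.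
Proof.
move=> a_neq0; rewrite /block_prod /blocks finsupp_mult_one //.
rewrite big_allpairs_dep big_seq_fset1 mult_oneE.
by apply: eq_bigr => b _; rewrite subst_pow1.
Qed.

Lemma PCom_sqfE d : (0 < d)%N ->
  PCom_sqf d = [set mult_one a | a in [set` compositions d d]]%classic.
Proof.
move=> d_gt0; apply/seteqP; split => delta /=.
  move=> [_ [a [comp_a sum_a ->]]]; exists a => //=.
  by rewrite mem_compositions // comp_a sum_a eqxx.
move=> [a]; rewrite mem_compositions // => /andP[comp_a /eqP sum_a] <-.
have a_neq0 : a != [::] by apply: contraTneq d_gt0 => a0; rewrite -sum_a a0.
split; last by exists a.
split; first by rewrite mult_oneE.
  by move=> r; rewrite mult_oneE; case: ifP.
by rewrite finsupp_mult_one // big_seq_fset1 mult_oneE mul1n.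
Qed.

Lemma sum_PCom_sqf d (G : indexed_comp -> series) : (0 < d)%N ->
  \sum_(delta \in PCom_sqf d) G delta =
  \sum_(a <- compositions d d) G (mult_one a).
Proof.
move=> d_gt0; rewrite PCom_sqfE // fsbig_image; last first.
  (* Injectivity of [mult_one]: [a] is recovered as the value at 1. *)
  move=> a b _ _ /(congr1 (fun delta : indexed_comp => delta 1%N)).
  by rewrite !mult_oneE.
by rewrite -fsbig_seq ?uniq_compositions.
Qed.

Lemma compositions_neq0 n d a :
  (0 < d <= n)%N -> a \in compositions n d -> a != [::].
Proof.
move=> /andP[d_gt0 le_dn]; rewrite mem_compositions // => /andP[_ /eqP sum_a].
by apply: contraTneq d_gt0 => a0; rewrite -sum_a a0.
Qed.

Theorem proposition14 (d : nat) (hd : (1 <= d)%N) :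
  P_ d = \sum_(delta \in PCom_sqf d)
           (-1) ^+ (plength delta - 1) * (L delta)%:R * block_prod H_ delta
  /\
  P_ d = \sum_(delta \in PCom_sqf d)
           (-1) ^+ plength delta * (L delta)%:R * block_prod E_ delta.
Proof.
have d_range : (0 < d <= d)%N by rewrite hd leqnn.
rewrite !sum_PCom_sqf //; split.
  rewrite -(sum_compositions_newton H_0 newton_H d_range).
  apply: eq_big_seq => a /(compositions_neq0 d_range) a_neq0.
  by rewrite plength_mult_one // L_mult_one // block_prod_mult_one.
(* For [E_] the recursion is solved by [- P_ a]; this sign turns the exponent [size a - 1] into
   [size a]. *)
have newton_E' n : \sum_(1 <= a < n.+1) - P_ a * E_ (n - a)%N = n%:R * E_ n.
  by rewrite -[RHS]opprK -newton_E -sumrN; apply: eq_bigr => a _; rewrite mulNr.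
rewrite -[LHS]opprK -(sum_compositions_newton E_0 newton_E' d_range) -sumrN.
apply: eq_big_seq => a /(compositions_neq0 d_range) a_neq0.
rewrite plength_mult_one // L_mult_one // block_prod_mult_one //.
by case: a a_neq0 => // b a _; rewrite subn1 /= exprS; ring.
Qed.
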